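(* Let $m\in\frac12\mathbf{Z}_{\ge0}$ and let $E=x_1^2x_2+x_2^2x_3+x_3^2x_1\in\mathbf{F}_2[x_1,x_2,x_3]$. As an $\mathbf{F}_2[x_1,x_2,x_3]^{S_3}$-module, $Q_m(3,\mathbf{F}_2)_{\mathrm{triv-triv}}$ is freely generated by (i.e. is free with basis) $1$ and $E\prod_{1\le i<j\le3}(x_i-x_j)^{2m}$.
   Context: $S_3$ acts on $\mathbf{F}_2[x_1,x_2,x_3]$ by permuting variables and $s_{ij}$ is the transposition of $x_i,x_j$. For $m\in\frac12\mathbf{Z}_{\ge0}$, $Q_m(3,\mathbf{F}_2)$ is the space of all $K\in\mathbf{F}_2[x_1,x_2,x_3]$ such that $(x_i-x_j)^{2m+1}$ divides $(1-s_{ij})K$ for all $1\le i<j\le3$. Let $\mathrm{triv}$ be the trivial representation of $S_3$ over $\mathbf{F}_2$, and $\mathrm{triv-triv}$ the $2$-dimensional indecomposable representation of $S_3$ over $\mathbf{F}_2$ containing a copy of $\mathrm{triv}$ with quotient $\mathrm{triv}$. $Q_m(3,\mathbf{F}_2)_{\mathrm{triv-triv}}$ is the sum of all subrepresentations of $Q_m(3,\mathbf{F}_2)$ isomorphic to $\mathrm{triv}$ or $\mathrm{triv-triv}$. *)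

(* Defs.v *)
From HB Require Import structures.
From mathcomp Require Import all_boot all_order all_algebra all_fingroup.
From mathcomp Require Import all_character.
From mathcomp Require Import mpoly.
Set Implicit Arguments.
Unset Strict Implicit.
Unset Printing Implicit Defensive.
Import GRing.Theory.
Local Open Scope ring_scope.

Notation poly3 := {mpoly 'F_2[3]}.

Notation S3_repr := (mx_representation 'F_2 [set: 'S_3]%G).

Definition mpoly_dvd (p q : poly3) : Prop := exists r : poly3, q = r * p.

(* Q_m(3, F_2) for m in (1/2)Z_{>=0}, parametrized by the natural number
   d = 2m. *)
Definition quasi_inv (d : nat) (K : poly3) : Prop :=
  forall i j : 'I_3, (i < j)%N ->
    mpoly_dvd (('X_i - 'X_j) ^+ d.+1) (K - msym (tperm i j) K).

Definition triv_mx (_ : 'S_3) : 'M['F_2]_1 := 1%:M.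

Lemma triv_mx_repr : mx_repr [set: 'S_3]%G triv_mx.
Proof. by split=> // s t _ _; rewrite /triv_mx mul1mx. Qed.

Definition triv_repr : S3_repr 1 := MxRepresentation triv_mx_repr.

Definition mx_indecomposable n (rG : S3_repr n) : Prop :=
  (0 < n)%N /\
  forall U V : 'M['F_2]_n, mxmodule rG U -> mxmodule rG V ->
    (U + V == 1%:M)%MS -> (U :&: V)%MS = 0 -> U = 0 \/ V = 0.

(* These properties determine the representation triv-triv up to
   isomorphism. *)
Definition is_triv_triv (rG : S3_repr 2) : Prop :=
  mx_indecomposable rG /\
  exists (U : 'M['F_2]_2) (modU : mxmodule rG U),
    mx_rsim (submod_repr modU) triv_repr /\
    mx_rsim (factmod_repr modU) triv_repr.

Definition subrepresentation (V W : poly3 -> Prop) : Prop :=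
  [/\ forall p, W p -> V p,
      W 0,
      forall (c : 'F_2) p q, W p -> W q -> W (c *: p + q) &
      forall (s : 'S_3) p, W p -> W (msym s p)].

(* msym s 'X_i = 'X_(s i).  Permutations compose from left to right here, so
   msym (s * t) = msym t \o msym s: this is a right action, matching the right
   action v |-> v *m rG s on row vectors of an mx_representation rG. *)
Definition isomorphic_repr (W : poly3 -> Prop) n (rG : S3_repr n) : Prop :=
  exists f : {linear 'rV['F_2]_n -> poly3},
    [/\ injective f,
        forall p, W p <-> exists v, p = f v &
        forall (s : 'S_3) v, f (v *m rG s) = msym s (f v)].

Definition subspace_sum (F : (poly3 -> Prop) -> Prop) (p : poly3) : Prop :=
  exists2 s : seq poly3,
    p = \sum_(q <- s) q & {in s, forall q, exists2 W, F W & W q}.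

Definition triv_triv_part (V : poly3 -> Prop) : poly3 -> Prop :=
  subspace_sum (fun W =>
    subrepresentation V W /\
    (isomorphic_repr W triv_repr \/
     exists2 rG : S3_repr 2, is_triv_triv rG & isomorphic_repr W rG)).

Definition sym_submodule (M : poly3 -> Prop) : Prop :=
  [/\ M 0,
      forall p q, M p -> M q -> M (p + q) &
      forall a p, a \is symmetric -> M p -> M (a * p)].

Definition sym_free_basis (M : poly3 -> Prop) n (g : n.-tuple poly3) : Prop :=
  [/\ sym_submodule M,
      forall p, M p <->
        exists2 a : 'I_n -> poly3, forall i, a i \is symmetric
          & p = \sum_i a i * tnth g i &
      forall a : 'I_n -> poly3, (forall i, a i \is symmetric) ->
        \sum_i a i * tnth g i = 0 -> forall i, a i = 0].

Definition x1 : poly3 := 'X_(@Ordinal 3 0 isT).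
Definition x2 : poly3 := 'X_(@Ordinal 3 1 isT).
Definition x3 : poly3 := 'X_(@Ordinal 3 2 isT).

Definition E : poly3 := x1 ^+ 2 * x2 + x2 ^+ 2 * x3 + x3 ^+ 2 * x1.

(* Main.v *)
Require Import Defs.
From HB Require Import structures.
From mathcomp Require Import all_boot all_order all_algebra all_fingroup.
From mathcomp Require Import all_character.
From mathcomp Require Import mpoly.
From mathcomp Require Import ring.
Set Implicit Arguments.
Unset Strict Implicit.
Unset Printing Implicit Defensive.
Import GRing.Theory.
Local Open Scope ring_scope.

(** Write [Delta] for the product of the three differences [x_i - x_j]; it is
    symmetric because signs are invisible in characteristic 2.

    In a triv-triv representation, an extension of triv by triv, every [rG s]
    is [1 + N s] with [N s *m N t = 0], so [s |-> N s] is additive; the braid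
    relation then gives all three transpositions the same action
    ([triv_triv_tperm]).  Hence an element [K] of the triv-triv part has one
    and the same difference [D = K - s_ij K] for all [i < j].  This [D] is
    symmetric and divisible by every [(x_i - x_j)^(d+1)], and since the linear
    forms [x_i - x_j] are pairwise non-associated primes, [D = b Delta^(d+1)]
    with [b] symmetric ([Delta_dvd]).  As [E - s_ij E = Delta] for every
    transposition, [K - b E Delta^d] is fixed by the transpositions, hence
    symmetric ([quasi_inv_decomp]).  This proves generation.

    Conversely a symmetric polynomial spans a copy of triv, and
    [g = b E Delta^d] together with [h = g - s_ij g = b Delta^(d+1)] spans a
    Jordan block, which is a copy of triv-triv ([jordan_triv_triv]).

    For freeness, applying [1 - s_12] to [a + b E Delta^d = 0] leaves
    [b Delta^(d+1) = 0], so [b = 0] and then [a = 0]. *)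

(** * Divisibility by powers of a difference of two variables *)

Section Identify.
Variables (n : nat) (R : idomainType).
Implicit Types (i j k : 'I_n) (p q g r : {mpoly R[n]}).

Definition identify i j : {mpoly R[n]} -> {mpoly R[n]} :=
  comp_mpoly [tuple if k == i then 'X_j else 'X_k | k < n].

HB.instance Definition _ i j := GRing.RMorphism.on (identify i j).

Lemma identifyX i j k : identify i j 'X_k = if k == i then 'X_j else 'X_k.
Proof. by rewrite /identify comp_mpolyXU -tnth_nth tnth_mktuple. Qed.

(** Together with [identify_sub] this says that the kernel of the substitution
    [X_i := X_j] is the ideal of [X_i - X_j], whence that ideal is prime. *)
Lemma sub_identify_dvd i j p :
  exists r, p - identify i j p = r * ('X_i - 'X_j).
Proof.
pose P q := exists r, q - identify i j q = r * ('X_i - 'X_j).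
have PM q1 q2 : P q1 -> P q2 -> P (q1 * q2).
  move=> [r1 e1] [r2 e2]; exists (r1 * q2 + identify i j q1 * r2).
  by rewrite mulrDl mulrAC -e1 -mulrA -e2 rmorphM /=; ring.
have P1 : P 1 by exists 0; rewrite rmorph1 subrr mul0r.
have PX m : P 'X_[m].
  rewrite mpolyXE_id; elim/big_ind: _ => // k _.
  elim: (m k) => [|e IHe]; first by rewrite expr0.
  rewrite exprS; apply: PM => //; rewrite /P identifyX.
  by case: eqP => [->|_]; [exists 1; rewrite mul1r | exists 0; rewrite subrr mul0r].
elim/mpolyind: p => [|c m p _ _ [r IHp]]; first by exists 0; rewrite rmorph0 subrr mul0r.
have [r' e'] := PX m; exists (c *: r' + r).
rewrite mulrDl -scalerAl -e' -IHp rmorphD /= {1}/identify comp_mpolyZ scalerBr.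
by rewrite opprD addrACA.
Qed.

Lemma mpolyX_sub_neq0 i j : i != j -> 'X_i - 'X_j != 0 :> {mpoly R[n]}.
Proof.
move=> nij; apply/eqP => /(congr1 (meval (fun k => (k == i)%:R))).
rewrite mevalB !mevalXU meval0 eqxx eq_sym (negPf nij) subr0.
by apply/eqP/oner_neq0.
Qed.

Lemma identify_sub i j : identify i j ('X_i - 'X_j) = 0.
Proof. by rewrite rmorphB /= !identifyX eqxx; case: eqP => _; rewrite subrr. Qed.

(** Coprimality with the prime [X_i - X_j] is expressed by
    [identify i j q != 0]; the factors of the power are then moved from the
    product to [g] one at a time. *)
Lemma dvd_linear_power_mull i j q g r e : i != j -> identify i j q != 0 ->
  q * g = r * ('X_i - 'X_j) ^+ e -> exists g', g = g' * ('X_i - 'X_j) ^+ e.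
Proof.
move=> nij nzq; elim: e g r => [|e IHe] g r; first by exists g; rewrite expr0 mulr1.
move=> eqg; have /eqP: identify i j (q * g) = 0.
  by rewrite eqg exprS mulrCA !rmorphM /= identify_sub mul0r.
rewrite rmorphM mulf_eq0 (negPf nzq) /= => /eqP g0.
have [g1 eg1] := sub_identify_dvd i j g; rewrite g0 subr0 in eg1.
have [|g' eg'] := IHe g1 r.
  apply: (mulIf (mpolyX_sub_neq0 nij)).
  by rewrite -mulrA -eg1 eqg exprSr mulrA.
by exists g'; rewrite eg1 eg' exprSr mulrA.
Qed.

End Identify.

(** * The polynomials E and Delta under transpositions *)

Notation o1 := (@Ordinal 3 0 isT).
Notation o2 := (@Ordinal 3 1 isT).
Notation o3 := (@Ordinal 3 2 isT).

Lemma ltn_ord3P (P : 'I_3 -> 'I_3 -> Prop) :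
  P o1 o2 -> P o1 o3 -> P o2 o3 -> forall i j : 'I_3, (i < j)%N -> P i j.
Proof.
move=> P12 P13 P23 [[|[|[|//]]] hi] [[|[|[|//]]] hj] //= _;
by rewrite ?(bool_irrelevance hi isT) ?(bool_irrelevance hj isT).
Qed.

Definition Delta : poly3 := (x1 - x2) * (x1 - x3) * (x2 - x3).

Lemma prod_ltn_ord3 (R : comNzRingType) (F : 'I_3 -> 'I_3 -> R) :
  \prod_(i < 3) \prod_(j < 3 | (i < j)%N) F i j = F o1 o2 * F o1 o3 * F o2 o3.
Proof.
have ord3 (G : 'I_3 -> R) : \prod_i G i = G o1 * (G o2 * G o3).
  rewrite !big_ord_recl big_ord0 mulr1.
  by congr (G _ * (G _ * G _)); apply: val_inj.
by rewrite ord3 !(big_mkcond (fun j : 'I_3 => _ < j)%N) !ord3 /= !mulr1 !mul1r.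
Qed.

Lemma prod_Delta d :
  \prod_(i < 3) \prod_(j < 3 | (i < j)%N) ('X_i - 'X_j) ^+ d = Delta ^+ d.
Proof. by rewrite prod_ltn_ord3 !exprMn. Qed.

Lemma Delta_neq0 : Delta != 0.
Proof. by rewrite /Delta !mulf_neq0 // mpolyX_sub_neq0. Qed.

Lemma msym_mpolyX n (R : nzRingType) (s : 'S_n) i :
  msym s 'X_i = 'X_(s i) :> {mpoly R[n]}.
Proof. by rewrite /msym mmapX mmap1U. Qed.

Lemma addvv_F2 (V : lmodType 'F_2) (v : V) : v + v = 0.
Proof.
have F2_two : 1 + 1 = 0 :> 'F_2 by apply: val_inj.
by rewrite -[v]scale1r -scalerDl F2_two scale0r.
Qed.

Lemma oppr_poly3 (p : poly3) : - p = p.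
Proof. by apply/eqP; rewrite eq_sym -addr_eq0 addvv_F2. Qed.

(** [E] is one half of the antisymmetric expansion of [Delta]: the three
    transpositions all exchange the two orientations of the cycle
    [x1 -> x2 -> x3], so they all give the same difference, with this sign in
    every characteristic. *)
Lemma E_sub_tperm (i j : 'I_3) : (i < j)%N -> E - msym (tperm i j) E = Delta.
Proof.
apply: (ltn_ord3P (P := fun i j => E - msym (tperm i j) E = Delta));
rewrite /E /Delta /x1 /x2 /x3 !(rmorphD, rmorphM, rmorphXn) /= !msym_mpolyX !permE /=; ring.
Qed.

Lemma tperm_Delta (i j : 'I_3) : (i < j)%N -> msym (tperm i j) Delta = Delta.
Proof.
move=> ltij; rewrite -[RHS]oppr_poly3.
(* With this sign the equality is an identity over the integers. *)
apply: (ltn_ord3P (P := fun i j => msym (tperm i j) Delta = - Delta)) ltij;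
rewrite /Delta /x1 /x2 /x3 !(rmorphB, rmorphM) /= !msym_mpolyX !permE /=; ring.
Qed.

(** When the transpositions differ, both sides are the third one. *)
Lemma braid_tperm (i j k l : 'I_3) : (i < j)%N -> (k < l)%N ->
  (tperm i j * tperm k l * tperm i j = tperm k l * tperm i j * tperm k l)%g.
Proof.
move: i j; apply: ltn_ord3P; move: k l; apply: ltn_ord3P;
apply/permP => -[[|[|[|//]]] h]; rewrite !permM !permE /=; apply: val_inj; reflexivity.
Qed.

(** Each further transposition adds [h] once more, and [h + h = 0], so only the
    parity of [s] matters. *)
Lemma msym_odd (g h : poly3) : h \is symmetric ->
  (forall i j : 'I_3, (i < j)%N -> g - msym (tperm i j) g = h) ->
  forall s : 'S_3, msym s g = g + (odd_perm s)%:R *: h.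
Proof.
move=> /issymP hsym gh s; have {}gh (i j : 'I_3) : i != j -> msym (tperm i j) g = g + h.
  have gh' (k l : 'I_3) : (k < l)%N -> msym (tperm k l) g = g + h.
    by move=> /gh <-; rewrite addrA addvv_F2 add0r oppr_poly3.
  by rewrite neq_ltn => /orP[/gh' //|/gh']; rewrite tpermC.
have [ts -> /[dup] /odd_perm_prod ->] := prod_tpermP s.
elim: ts => [|t ts IHts] /=; first by rewrite big_nil msym1m scale0r addr0.
case/andP=> dt /IHts IH; rewrite big_cons msymMm gh // msymD hsym IH.
by case: (odd _); rewrite /= ?scale1r ?scale0r ?addr0 // -addrA addvv_F2 addr0.
Qed.

Lemma tperm_symmetric (p : poly3) :
  (forall i j : 'I_3, (i < j)%N -> msym (tperm i j) p = p) -> p \is symmetric.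
Proof.
move=> hp; apply/issymP => s; rewrite (@msym_odd p 0) ?scaler0 ?addr0 ?rpred0 //.
by move=> i j /hp ->; rewrite subrr.
Qed.

Lemma Delta_sym : Delta \is symmetric.
Proof. exact: tperm_symmetric tperm_Delta. Qed.

(** The quotient by one power is still divisible by the next one, because
    identifying two variables does not kill the difference of another pair. *)
Lemma Delta_dvd e (p : poly3) :
  (forall i j : 'I_3, (i < j)%N -> mpoly_dvd (('X_i - 'X_j) ^+ e) p) ->
  mpoly_dvd (Delta ^+ e) p.
Proof.
move=> dvdp.
have [r er] := dvdp o1 o2 isT; have [r2 er2] := dvdp o1 o3 isT.
have [r3 er3] := dvdp o2 o3 isT.
have [r' er'] : mpoly_dvd (('X_o1 - 'X_o3) ^+ e) r.
  have eq_r : ('X_o1 - 'X_o2) ^+ e * r = r2 * ('X_o1 - 'X_o3) ^+ e.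
    by rewrite [LHS]mulrC -er -er2.
  apply: dvd_linear_power_mull eq_r; first by [].
  by rewrite rmorphXn rmorphB /= !identifyX /= expf_neq0 // mpolyX_sub_neq0.
have [r'' er''] : mpoly_dvd (('X_o2 - 'X_o3) ^+ e) r'.
  have eq_r' : ('X_o1 - 'X_o3) ^+ e * ('X_o1 - 'X_o2) ^+ e * r'
      = r3 * ('X_o2 - 'X_o3) ^+ e.
    by rewrite [LHS]mulrC mulrA -er' -er -er3.
  apply: dvd_linear_power_mull eq_r'; first by [].
  rewrite rmorphM !rmorphXn !rmorphB /= !identifyX /=.
  by rewrite mulf_neq0 // expf_neq0 // mpolyX_sub_neq0.
exists r''; rewrite er er' er'' /Delta !exprMn /x1 /x2 /x3.
(* The powers are made opaque so that the identity is one in three atoms. *)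
set a := ('X_o1 - 'X_o2) ^+ e; set b := ('X_o1 - 'X_o3) ^+ e.
by set c := ('X_o2 - 'X_o3) ^+ e; move: a b c => a b c; ring.
Qed.

Lemma dvd_Delta e (b : poly3) (i j : 'I_3) : (i < j)%N ->
  mpoly_dvd (('X_i - 'X_j) ^+ e) (b * Delta ^+ e).
Proof.
move=> ltij; have [c ->] : mpoly_dvd ('X_i - 'X_j) Delta.
  move: i j ltij; apply: ltn_ord3P.
  - exists (('X_o1 - 'X_o3) * ('X_o2 - 'X_o3)).
    by rewrite /Delta /x1 /x2 /x3 -[LHS]mulrA [LHS]mulrC.
  - exists (('X_o1 - 'X_o2) * ('X_o2 - 'X_o3)).
    by rewrite /Delta /x1 /x2 /x3 [LHS]mulrAC.
  - by exists (('X_o1 - 'X_o2) * ('X_o1 - 'X_o3)).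
by exists (b * c ^+ e); rewrite exprMn mulrA.
Qed.

(** * Decomposition of quasi-invariants on which the transpositions agree *)

(** The coefficient [b] is forced: it is the quotient by [Delta ^+ d.+1] of the
    common difference [D], since [E * Delta ^+ d] has difference
    [Delta ^+ d.+1]. *)
Lemma quasi_inv_decomp d (K : poly3) : quasi_inv d K ->
  (forall i j k l : 'I_3, (i < j)%N -> (k < l)%N ->
     msym (tperm i j) K = msym (tperm k l) K) ->
  exists a b, [/\ a \is symmetric, b \is symmetric & K = a + b * (E * Delta ^+ d)].
Proof.
move=> qK eqK; pose D := K - msym (tperm o1 o2) K.
have KD (i j : 'I_3) : (i < j)%N -> K - msym (tperm i j) K = D.
  by move=> lt; rewrite /D (eqK i j o1 o2).
have Dsym : D \is symmetric.
  apply: tperm_symmetric => i j lt; rewrite -(KD i j lt) msymB -msymMm tperm2 msym1m.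
  exact: etrans (esym (opprB _ _)) (oppr_poly3 _).
have [b Db] : mpoly_dvd (Delta ^+ d.+1) D.
  by apply: Delta_dvd => i j lt; rewrite -(KD i j lt); apply: qK.
have bsym : b \is symmetric.
  apply: (@msymMK _ _ (Delta ^+ d.+1)); last by rewrite mulrC -Db.
  - by rewrite expf_neq0 ?Delta_neq0.
  - by rewrite rpredX ?Delta_sym.
exists (K - b * (E * Delta ^+ d)), b; split; [|exact: bsym|by rewrite subrK].
have /issymP bs := bsym; have /issymP Ds := Delta_sym.
apply: tperm_symmetric => i j lt.
rewrite msymB !msymM rmorphXn /= bs Ds.
have -> : msym (tperm i j) E = E - Delta by rewrite -(E_sub_tperm lt); ring.
have -> : msym (tperm i j) K = K - D by rewrite -(KD i j lt); ring.
by rewrite Db exprS; ring.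
Qed.

(** * The representation triv-triv *)

Section TrivTriv.
Variables (rG : S3_repr 2) (ttG : is_triv_triv rG).

Lemma triv_rsim_id n (rH : S3_repr n) s : mx_rsim rH triv_repr -> rH s = 1%:M.
Proof. by move/mx_rsim_sym=> /(mx_rsim_scalar (in_setT s)); apply. Qed.

(** [rG s - 1] maps the whole space into the trivial submodule [U], because the
    quotient is trivial, and [rG t - 1] kills [U]. *)
Lemma triv_triv_unipotent s t : (rG s - 1%:M) *m (rG t - 1%:M) = 0.
Proof.
have [_ [U [modU [simU simQ]]]] := ttG.
have fixU x : U *m rG x = U.
  have sUU : (U *m rG x <= U)%MS by apply: (mxmoduleP modU); rewrite inE.
  rewrite -(in_submodK sUU) in_submodJ // -/(submod_repr modU x).
  by rewrite (triv_rsim_id x simU) mulmx1 in_submodK.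
have /submxP[A ->] : (rG s - 1%:M <= U)%MS.
  rewrite -in_factmod_eq0 linearB /= -[rG s]mul1mx in_factmodJ ?inE //.
  by rewrite -/(factmod_repr modU s) (triv_rsim_id s simQ) mulmx1 subrr.
by rewrite -mulmxA mulmxBr mulmx1 fixU subrr mulmx0.
Qed.

(** By unipotence [rG - 1] is additive on products, so in characteristic 2
    conjugating [t] by an involution [s] changes nothing; the braid relation
    writes one element as a conjugate of either transposition. *)
Lemma triv_triv_tperm (i j k l : 'I_3) : (i < j)%N -> (k < l)%N ->
  rG (tperm i j) = rG (tperm k l).
Proof.
move=> ltij ltkl.
have rGM s t : rG (s * t)%g = rG s + rG t - 1%:M.
  rewrite repr_mxM ?inE //; apply/eqP; rewrite -subr_eq0 -(triv_triv_unipotent s t).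
  rewrite mulmxBl !mulmxBr !mulmx1 mul1mx.
  by rewrite !opprD !opprK !addrA [_ - rG t]addrAC.
have rG3 s t : rG (s * t * s)%g = rG t.
  rewrite !rGM; set A := rG s; set B := rG t.
  by rewrite (addrC A) -!addrA (addrCA (- _) A) addvv_F2 addr0 addvv_F2 addr0.
by rewrite -(rG3 (tperm k l)) -(braid_tperm ltij ltkl) rG3.
Qed.
End TrivTriv.

Section Jordan.

(** Odd permutations act by the Jordan block fixing the row vector [e_0] and
    sending [e_1] to [e_1 + e_0]. *)
Definition jordan_mx (s : 'S_3) : 'M['F_2]_2 :=
  1%:M + (odd_perm s)%:R *: delta_mx 1 0.

Lemma jordan_mx_repr : mx_repr [set: 'S_3]%G jordan_mx.
Proof.
split=> [|s t _ _]; first by rewrite /jordan_mx odd_perm1 scale0r addr0.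
rewrite /jordan_mx odd_permM mulmxDl mul1mx mulmxDr mulmx1 -scalemxAl -scalemxAr.
rewrite mul_delta_mx_0 // !scaler0 addr0 -addrA -scalerDl; congr (_ + _ *: _).
by case: (odd_perm s); case: (odd_perm t); apply: val_inj.
Qed.

Definition jordan_repr : S3_repr 2 := MxRepresentation jordan_mx_repr.

Lemma row_jordan_mxE (v : 'rV['F_2]_2) s j :
  (v *m jordan_mx s) 0 j = v 0 j + (odd_perm s)%:R * (v 0 1 * (j == 0)%:R).
Proof.
rewrite /jordan_mx mulmxDr mulmx1 -scalemxAr !mxE !big_ord_recl big_ord0 !mxE /=.
have -> : lift ord0 ord0 = 1 :> 'I_2 by apply: val_inj.
by rewrite mulr0 add0r addr0.
Qed.

Lemma F2_cases (c : 'F_2) : c = 0 \/ c = 1.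
Proof. by case: c => -[|[|//]] h; [left|right]; apply: val_inj. Qed.

Lemma rV2_e0 (v : 'rV['F_2]_2) : v 0 1 = 0 -> v = v 0 0 *: delta_mx 0 0.
Proof.
move=> v1; apply/rowP=> -[[|[|//]] h]; rewrite !mxE /= ?mulr1 ?mulr0.
  by congr (v 0 _); apply: val_inj.
by rewrite -[RHS]v1; congr (v 0 _); apply: val_inj.
Qed.

(** The line of [e_0] is the socle: if [v] has nonzero second coordinate, a
    transposition moves it by exactly [e_0].  Two nonzero submodules therefore
    always meet, which gives indecomposability. *)
Lemma jordan_mxmodule_e0 (U : 'M['F_2]_2) : mxmodule jordan_repr U -> U != 0 ->
  ((delta_mx 0 0 : 'rV['F_2]_2) <= U)%MS.
Proof.
move=> modU /rowV0Pn[v vU nzv].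
have [v0|v1] := F2_cases (v 0 1).
  have := rV2_e0 v0; case: (F2_cases (v 0 0)) => ->; rewrite ?scale0r ?scale1r.
    by move=> v00; rewrite v00 eqxx in nzv.
  by move=> <-.
have -> : delta_mx 0 0 = v *m jordan_mx (tperm o1 o2) - v.
  apply/rowP=> j; rewrite [RHS]mxE row_jordan_mxE odd_tperm [(- v) _ _]mxE addrC addKr.
  by rewrite mxE v1 !mul1r.
rewrite addmx_sub ?eqmx_opp //.
by apply: submx_trans (mxmoduleP modU _ (in_setT (tperm o1 o2))); apply: submxMr.
Qed.

(** The only unit of F_2 is 1. *)
Lemma dim1_triv n (rH : S3_repr n) : n = 1%N -> mx_rsim rH triv_repr.
Proof.
move=> n1; subst n; exists 1%:M => //; first by rewrite row_free_unit unitmx1.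
move=> s sG; rewrite mulmx1 mul1mx /= /triv_mx.
have := repr_mx_unit rH sG; rewrite [rH s]mx11_scalar.
by case: (F2_cases (rH s 0 0)) => -> //; rewrite unitmxE det_scalar1 unitr0.
Qed.

Lemma jordan_triv_triv : is_triv_triv jordan_repr.
Proof.
split.
  split=> // U V modU modV _ UV0.
  have [->|nzU] := eqVneq U 0; first by left.
  have [->|nzV] := eqVneq V 0; first by right.
  have: ((delta_mx 0 0 : 'rV['F_2]_2) <= U :&: V)%MS.
    by rewrite sub_capmx !jordan_mxmodule_e0.
  by rewrite UV0 submx0 => /eqP/matrixP/(_ 0 0); rewrite !mxE.
pose U : 'M['F_2]_2 := delta_mx 0 0.
have modU : mxmodule jordan_repr U.
  apply/mxmoduleP => s _; rewrite /= /jordan_mx mulmxDr mulmx1 -scalemxAr.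
  by rewrite mul_delta_mx_0 // scaler0 addr0.
have rkU : \rank U = 1%N by rewrite mxrank_delta.
exists U, modU; split; apply: dim1_triv => //.
by rewrite mxrank_coker rkU.
Qed.

End Jordan.

(** * The triv-triv part of the quasi-invariants *)

Lemma quasi_inv_linear d (c : 'F_2) p q :
  quasi_inv d p -> quasi_inv d q -> quasi_inv d (c *: p + q).
Proof.
move=> qp qq i j lt; have [r er] := qp i j lt; have [t et] := qq i j lt.
exists (c *: r + t); rewrite mulrDl -scalerAl -er -et msymD msymZ scalerBr.
by rewrite opprD addrACA.
Qed.

Lemma quasi_inv_sym d p : p \is symmetric -> quasi_inv d p.
Proof. by move/issymP=> sp i j _; exists 0; rewrite sp subrr mul0r. Qed.

Lemma image_subrepresentation V n (rG : S3_repr n) (f : 'rV['F_2]_n -> poly3) :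
  linear f -> (forall v, f v = 0 -> v = 0) -> (forall v, V (f v)) ->
  (forall (s : 'S_3) v, f (v *m rG s) = msym s (f v)) ->
  let W p := exists v, p = f v in
  subrepresentation V W /\ isomorphic_repr W rG.
Proof.
move=> linf kerf Vf fJ W.
pose linf_mixin := GRing.isLinear.Build 'F_2 'rV['F_2]_n poly3 _ f linf.
pose F : {linear 'rV['F_2]_n -> poly3} := HB.pack f linf_mixin.
split; last by exists F; split; first exact/raddf_inj/kerf.
split.
- by move=> _ [v ->].
- by exists 0; rewrite -[f]/(F : _ -> _) linear0.
- by move=> c _ _ [u ->] [v ->]; exists (c *: u + v); rewrite linf.
- by move=> s _ [v ->]; exists (v *m rG s); rewrite fJ.
Qed.

Lemma triv_triv_partD V p q :
  triv_triv_part V p -> triv_triv_part V q -> triv_triv_part V (p + q).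
Proof.
move=> [s -> hs] [t -> ht]; exists (s ++ t); first by rewrite big_cat.
by move=> x; rewrite mem_cat => /orP[/hs|/ht].
Qed.

Lemma triv_triv_part0 V : triv_triv_part V 0.
Proof. by exists [::]; rewrite ?big_nil. Qed.

Lemma mem_triv_triv_part V p W : W p -> subrepresentation V W ->
  (isomorphic_repr W triv_repr \/
   exists2 rG : S3_repr 2, is_triv_triv rG & isomorphic_repr W rG) ->
  triv_triv_part V p.
Proof.
move=> Wp sW iW; exists [:: p]; first by rewrite big_seq1.
by move=> q; rewrite inE => /eqP ->; exists W.
Qed.

Lemma sym_triv_triv_part d a : a \is symmetric -> triv_triv_part (quasi_inv d) a.
Proof.
move=> asym; have [->|nza] := eqVneq a 0; first exact: triv_triv_part0.
pose f (v : 'rV['F_2]_1) := v 0 0 *: a.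
have [|v /eqP|v|s v|sW iW] := @image_subrepresentation (quasi_inv d) _ triv_repr f.
- by move=> c u v; rewrite /f !mxE scalerDl scalerA.
- rewrite scaler_eq0 (negPf nza) orbF => /eqP v0.
  by apply/rowP => i; rewrite ord1 v0 mxE.
- by apply: quasi_inv_sym; rewrite rpredZ.
- by rewrite -[triv_repr s]/(1%:M) mulmx1 msymZ (issymP _ asym).
apply: (mem_triv_triv_part _ sW); last by left.
by exists (const_mx 1); rewrite /f mxE scale1r.
Qed.

(** [g] corresponds to the basis vector [e_1] and [h] to [e_0].  Independence
    comes from applying a transposition to a relation, which isolates the
    coefficient of [g]. *)
Lemma jordan_triv_triv_part d g h : h \is symmetric -> h != 0 -> quasi_inv d g ->
  (forall i j : 'I_3, (i < j)%N -> g - msym (tperm i j) g = h) ->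
  triv_triv_part (quasi_inv d) g.
Proof.
move=> hsym nzh qg gh; have gJ := msym_odd hsym gh.
pose f (v : 'rV['F_2]_2) := v 0 0 *: h + v 0 1 *: g.
have scale_eq0 (c : 'F_2) : c *: h = 0 -> c = 0.
  by move/eqP; rewrite scaler_eq0 (negPf nzh) orbF => /eqP.
have [|v fv0|v|s v|sW iW] := @image_subrepresentation (quasi_inv d) _ jordan_repr f.
- by move=> c u v; rewrite /f !mxE !scalerDl scalerDr !scalerA addrACA.
- have v1 : v 0 1 = 0.
    apply: scale_eq0; move/(congr1 (msym (tperm o1 o2))): (fv0).
    rewrite msymD !msymZ gJ odd_tperm scale1r (issymP _ hsym) scalerDr addrA.
    by rewrite -/(f v) fv0 add0r msym0.
  move: fv0; rewrite /f v1 scale0r addr0 => /scale_eq0 v0.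
  by rewrite (rV2_e0 v1) v0 scale0r.
- apply: quasi_inv_linear; first exact: quasi_inv_sym.
  rewrite -[_ *: g]addr0; apply: quasi_inv_linear; first exact: qg.
  by apply: quasi_inv_sym; apply: rpred0.
- rewrite /f -[jordan_repr s]/(jordan_mx s) !row_jordan_mxE /= mulr1 !mulr0 addr0.
  rewrite msymD !msymZ gJ (issymP _ hsym).
  by rewrite scalerDl scalerDr scalerA [in RHS]mulrC -addrA [_ *: h + _ *: g]addrC.
apply: (mem_triv_triv_part _ sW); last first.
  by right; exists jordan_repr; first exact: jordan_triv_triv.
by exists (delta_mx 0 1); rewrite /f !mxE /= scale0r scale1r add0r.
Qed.

(** A polynomial is in the sum only through its summands, each lying in a single
    subrepresentation; so it suffices to decompose these and add up. *)
Lemma triv_triv_partP d p : triv_triv_part (quasi_inv d) p <->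
  exists a b, [/\ a \is symmetric, b \is symmetric & p = a + b * (E * Delta ^+ d)].
Proof.
split=> [[s -> hs]|[a [b [asym bsym ->]]]]; last first.
  apply: triv_triv_partD; first exact: sym_triv_triv_part.
  have [->|nzb] := eqVneq b 0; first by rewrite mul0r; apply: triv_triv_part0.
  have Kb (i j : 'I_3) : (i < j)%N -> b * (E * Delta ^+ d)
      - msym (tperm i j) (b * (E * Delta ^+ d)) = b * Delta ^+ d.+1.
    move=> lt; rewrite !msymM rmorphXn /= (issymP _ bsym) (issymP _ Delta_sym).
    by rewrite exprS; move: (Delta ^+ d) => P; rewrite -(E_sub_tperm lt); ring.
  apply: (jordan_triv_triv_part _ _ _ Kb).
  - by rewrite rpredM ?rpredX ?Delta_sym.
  - by rewrite mulf_neq0 ?expf_neq0 ?Delta_neq0.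
  - by move=> i j lt; rewrite (Kb i j lt); apply: dvd_Delta.
elim: s hs => [|q s IHs] hs.
  by exists 0, 0; rewrite big_nil mul0r addr0; split; rewrite ?rpred0.
have [|a [b [asym bsym eqs]]] := IHs; first by move=> x xs; apply: hs; rewrite inE xs orbT.
have [a' [b' [asym' bsym' eqq]]] : exists a b,
    [/\ a \is symmetric, b \is symmetric & q = a + b * (E * Delta ^+ d)].
  have [W [[sWV _ _ _] iW] Wq] := hs q (mem_head _ _).
  apply: quasi_inv_decomp (sWV _ Wq) _ => i j k l ltij ltkl.
  case: iW => [[f [_ Wf fJ]]|[rG ttG [f [_ Wf fJ]]]];
    have /Wf[v ->] := Wq; rewrite -!fJ //.
  by rewrite (triv_triv_tperm ttG ltij ltkl).
exists (a' + a), (b' + b); split; [exact: rpredD|exact: rpredD|].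
by rewrite big_cons eqq eqs (mulrDl b' b) addrACA.
Qed.

(* d = 2m *)
Theorem proposition3p1 (d : nat) :
  sym_free_basis (triv_triv_part (quasi_inv d))
    [tuple (1 : poly3);
           E * \prod_(i < 3) \prod_(j < 3 | (i < j)%N) ('X_i - 'X_j) ^+ d].
Proof.
rewrite prod_Delta.
have sumE (a : 'I_2 -> poly3) :
    \sum_i a i * tnth [tuple 1; E * Delta ^+ d] i = a 0 + a 1 * (E * Delta ^+ d).
  rewrite !big_ord_recl big_ord0 addr0 !(tnth_nth 0) /= mulr1.
  by congr (_ + a _ * _); apply: val_inj.
split.
- split; first exact: triv_triv_part0.
    exact: triv_triv_partD.
  move=> a _ asym /triv_triv_partP[a' [b' [sa sb ->]]]; apply/triv_triv_partP.
  exists (a * a'), (a * b'); split; [exact: rpredM|exact: rpredM|].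
  by rewrite mulrDr (mulrA a b').
- move=> p; split.
    move/triv_triv_partP=> [a [b [sa sb ->]]].
    exists (fun i => if i == 0 then a else b); last by rewrite sumE.
    by move=> i; case: ifP.
  by move=> [a sa ->]; rewrite sumE; apply/triv_triv_partP; exists (a 0), (a 1).
- move=> a sa; rewrite sumE => ab0.
  have b0 : a 1 = 0.
    have sab0 : a 0 + a 1 * (msym (tperm o1 o2) E * Delta ^+ d) = 0.
      have := congr1 (msym (tperm o1 o2)) ab0.
      by rewrite msymD !msymM rmorphXn /= !(issymP _ (sa _)) (issymP _ Delta_sym) msym0.
    have /eqP : a 1 * (Delta * Delta ^+ d) = 0.
      rewrite -{1}(@E_sub_tperm o1 o2 isT).
      transitivity (a 0 + a 1 * (E * Delta ^+ d)
                    - (a 0 + a 1 * (msym (tperm o1 o2) E * Delta ^+ d))); first by ring.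
      by rewrite ab0 sab0 subrr.
    by rewrite mulf_eq0 -exprS expf_eq0 (negPf Delta_neq0) andbF orbF => /eqP.
  move: ab0; rewrite b0 mul0r addr0 => a0 [[|[|//]] h].
    by rewrite -[RHS]a0; congr (a _); apply: val_inj.
  by rewrite -[RHS]b0; congr (a _); apply: val_inj.
Qed.
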